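(* Let $\kappa$ be an infinite cardinal and let $(X_\alpha)_{\alpha\in A}$ be a family of ${\updownarrow}\kappa$-complete topologized posets. Then the Tychonoff product $X:=\prod_{\alpha\in A}X_\alpha$ is an ${\updownarrow}\kappa$-complete topologized poset.
   Context: A topologized poset is a partially ordered set $(X,\le)$ endowed with a topology (no compatibility between order and topology is assumed). $\overline{D}$ denotes the closure of $D$. A subset $D\subseteq X$ is up-directed (resp. down-directed) if for any $x,y\in D$ there is $z\in D$ with $x\le z$ and $y\le z$ (resp. $z\le x$ and $z\le y$). For a cardinal $\kappa$, a topologized poset $X$ is ${\uparrow}\kappa$-complete if each nonempty up-directed set $D\subseteq X$ with $|D|\le\kappa$ has a least upper bound $\sup D$ in $X$ and $\sup D\in\overline{D}$; it is ${\downarrow}\kappa$-complete if each nonempty down-directed set $D\subseteq X$ with $|D|\le\kappa$ has a greatest lower bound $\inf D$ in $X$ and $\inf D\in\overline{D}$; it is ${\updownarrow}\kappa$-complete if it is both ${\uparrow}\kappa$-complete and ${\downarrow}\kappa$-complete. The Tychonoff product $\prod_{\alpha\in A}X_\alpha$ of topologized posets $(X_\alpha,\le_\alpha)$ carries the product topology and the pointwise partial order: $(x_\alpha)_{\alpha\in A}\le(y_\alpha)_{\alpha\in A}$ iff $x_\alpha\le_\alpha y_\alpha$ for each $\alpha\in A$. *)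

(* Defs.v *)
From HB Require Import structures.
From mathcomp Require Import all_boot all_order.
From mathcomp Require Import boolp classical_sets functions cardinality.
From mathcomp Require Import topology function_spaces.

Set Implicit Arguments.
Unset Strict Implicit.
Unset Printing Implicit Defensive.

Import Order.TTheory.
Local Open Scope classical_set_scope.
Local Open Scope card_scope.

(* A topologized poset is a [POrderedTopological.type d]: the bare join of the
   topological and partial-order structures, with no compatibility axiom. *)

(* The pointwise order on a dependent product, attached to the library's
   [prod_topology] so that products of topologized posets are again
   topologized posets. *)
Section PointwiseOrder.
Context {d : Order.disp_t} {I : Type} {T : I -> porderType d}.
Implicit Types x y z : prod_topology T.

Definition prod_le x y : bool := `[< forall i, (x i <= y i)%O >].

Lemma prod_le_refl : reflexive prod_le.
Proof. by move=> x; apply/asboolP => i. Qed.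

Lemma prod_le_anti : antisymmetric prod_le.
Proof.
move=> x y /andP[/asboolP xy /asboolP yx].
by apply: functional_extensionality_dep => i; apply: le_anti; rewrite xy yx.
Qed.

Lemma prod_le_trans : transitive prod_le.
Proof.
move=> y x z /asboolP xy /asboolP yz; apply/asboolP => i.
exact: le_trans (xy i) (yz i).
Qed.

HB.instance Definition _ := Order.Le_isPOrder.Build d (prod_topology T)
  prod_le_refl prod_le_anti prod_le_trans.

Lemma prod_leP x y : reflect (forall i, (x i <= y i)%O) (x <= y)%O.
Proof. exact: asboolP. Qed.

End PointwiseOrder.

HB.instance Definition _ (d : Order.disp_t) (I : Type)
    (T : I -> POrderedTopological.type d) :=
  Order.POrder.on (prod_topology T).

Definition up_directed (d : Order.disp_t) (X : porderType d) (D : set X) :=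
  forall x y, D x -> D y -> exists z, [/\ D z, (x <= z)%O & (y <= z)%O].

Definition down_directed (d : Order.disp_t) (X : porderType d) (D : set X) :=
  forall x y, D x -> D y -> exists z, [/\ D z, (z <= x)%O & (z <= y)%O].

(* A cardinal is represented by a type [K] of that cardinality: [|D| <= K] is
   the existence of an injection from [D] to [K]. *)
Definition up_complete (K : Type) (d : Order.disp_t)
    (X : POrderedTopological.type d) :=
  forall D : set X, D !=set0 -> up_directed D -> D #<= [set: K] ->
    exists s, supremums D s /\ closure D s.

Definition down_complete (K : Type) (d : Order.disp_t)
    (X : POrderedTopological.type d) :=
  forall D : set X, D !=set0 -> down_directed D -> D #<= [set: K] ->
    exists s, infimums D s /\ closure D s.

Definition updown_complete (K : Type) (d : Order.disp_t)
    (X : POrderedTopological.type d) :=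
  up_complete K X /\ down_complete K X.

(* Main.v *)
Require Import Defs.
From mathcomp Require Import all_boot all_order.
From mathcomp Require Import boolp classical_sets functions cardinality.
From mathcomp Require Import filter topology function_spaces.
Import Order.TTheory.
Local Open Scope classical_set_scope.
Local Open Scope card_scope.

(* Suprema in the product are computed coordinatewise.  The point is that a
   directed set D, viewed as a net, converges in each coordinate to its
   supremum there, because completeness also applies to cofinal subsets of D;
   convergence in each coordinate is convergence in the product, so the supremum
   lies in the closure of D. *)

(* Stated for a bare relation, so that one argument serves both the order and
   its converse. *)
Definition directed_by {T : Type} (r : rel T) (D : set T) :=
  forall x y, D x -> D y -> exists z, [/\ D z, r x z & r y z].

Definition lub_by {T : Type} (r : rel T) (D : set T) (s : T) :=
  (forall x, D x -> r x s) /\ (forall y, (forall x, D x -> r x y) -> r s y).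

Definition complete_by (K : Type) {T : topologicalType} (r : rel T) :=
  forall D : set T, D !=set0 -> directed_by r D -> D #<= [set: K] ->
    exists s, lub_by r D s /\ closure D s.

(** The section filter of [D]: convergence along it is convergence of [D] as a net indexed by
    itself. *)
Definition tails {T : Type} (r : rel T) (D : set T) : set_system T :=
  filter_from D (fun x => [set y | D y /\ r x y]).

Lemma tails_proper (T : Type) (r : rel T) (D : set T) :
  reflexive r -> transitive r -> D !=set0 -> directed_by r D ->
  ProperFilter (tails r D).
Proof.
move=> rr rt D0 dD; apply: filter_from_proper; last first.
  by move=> x Dx; exists x; split.
apply: filter_from_filter => // x y Dx Dy.
have [z [Dz xz yz]] := dD _ _ Dx Dy.
by exists z => // w [Dw zw]; split; split=> //; [exact: rt xz zw|exact: rt yz zw].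
Qed.

Lemma directed_by_image (Y T : Type) (rY : rel Y) (r : rel T) (f : Y -> T)
    (D : set Y) :
  {homo f : x y / rY x y >-> r x y} -> directed_by rY D ->
  directed_by r (f @` D).
Proof.
move=> fmono dD _ _ [x Dx <-] [y Dy <-].
have [z [Dz xz yz]] := dD _ _ Dx Dy.
by exists (f z); split; [exists z|exact: fmono|exact: fmono].
Qed.

(* If the image net did not converge, the points of [D] sent outside some
   neighbourhood of [s] would be cofinal in [D]: their image would be directed
   with the same supremum [s], yet [s] would not be in its closure. *)
Lemma cvg_tails (K Y : Type) (rY : rel Y) (T : topologicalType) (r : rel T)
    (f : Y -> T) (D : set Y) (s : T) :
  transitive rY -> antisymmetric r -> transitive r ->
  {homo f : x y / rY x y >-> r x y} ->
  complete_by K r -> D !=set0 -> directed_by rY D -> D #<= [set: K] ->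
  lub_by r (f @` D) s ->
  f @ tails rY D --> s.
Proof.
move=> rYt ra rt fmono cT D0 dD DK [ubs lubs] U Us; apply: contrapT => nU.
pose D' := [set y | D y /\ ~ U (f y)].
(* Otherwise [f] would send the whole tail above some [x] into [U], against [nU]. *)
have cofD' x : D x -> exists2 y, D' y & rY x y.
  move=> Dx; apply: contrapT => nx; apply: nU; exists x => // y [Dy xy].
  by apply: contrapT => nUy; apply: nx; exists y.
have [||| s' [[ubs' lubs'] cls']] := cT (f @` D').
- by have [x /cofD'[y D'y _]] := D0; exists (f y), y.
- apply: directed_by_image fmono _ => x y [Dx _] [Dy _].
  have [z [/cofD'[w D'w zw] xz yz]] := dD _ _ Dx Dy.
  by exists w; split=> //; [exact: rYt xz zw|exact: rYt yz zw].
- apply: card_le_trans (card_image_le _ _) _; apply: card_le_trans DK.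
  by apply: subset_card_le => y [].
have s's : s' = s.
  apply: ra; apply/andP; split.
    by apply: lubs' => _ [y [Dy _] <-]; apply: ubs; exists y.
  apply: lubs => _ [x /cofD'[y D'y xy] <-].
  by apply: (rt (f y)); [exact: fmono|apply: ubs'; exists y].
by rewrite s's in cls'; have [_ [[y [_ nUy] <-] /nUy]] := cls' U Us.
Qed.

(** The product topology is the supremum of the topologies induced by the projections, so preimages
    of open sets under a single projection suffice. *)
Lemma cvg_prod_topology (I : Type) (T : I -> topologicalType)
    (F : set_system (prod_topology T)) (s : prod_topology T) :
  Filter F -> (forall i, (fun x => x i) @ F --> s i) -> F --> s.
Proof.
move=> FF Fs; apply/cvg_sup => i U [_ [[B Bop <-] Bsi sBU]].
apply: (@filterS _ F _ _ _ sBU).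
by apply: (Fs i); exact: open_nbhs_nbhs.
Qed.

Lemma complete_by_prod (K I : Type) (T : I -> topologicalType)
    (r : forall i, rel (T i)) (R : rel (prod_topology T)) :
  (forall i, reflexive (r i)) -> (forall i, antisymmetric (r i)) ->
  (forall i, transitive (r i)) ->
  (forall x y, reflect (forall i, r i (x i) (y i)) (R x y)) ->
  (forall i, complete_by K (r i)) -> complete_by K R.
Proof.
move=> rr ra rt RP cT D D0 dD DK.
have Rr : reflexive R by move=> x; apply/RP => i; exact: rr.
have Rt : transitive R.
  by move=> y x z /RP xy /RP yz; apply/RP => i; exact: rt (xy i) (yz i).
have Rproj i : {homo (fun x : prod_topology T => x i) : x y / R x y >-> r i x y}.
  by move=> x y /RP.
have lubD i : exists t, lub_by (r i) ((fun x => x i) @` D) t.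
  (* The closure clause is dropped: membership in each coordinate closure would not put [s] in the
     closure of [D]. *)
  have [|||t [tP _]] := cT i ((fun x => x i) @` D); last by exists t.
  - by have [x Dx] := D0; exists (x i), x.
  - exact: directed_by_image (Rproj i) dD.
  - exact: card_le_trans (card_image_le _ _) DK.
pose s : prod_topology T := fun i => projT1 (cid (lubD i)).
have sP i : lub_by (r i) ((fun x => x i) @` D) (s i) by exact: projT2 (cid _).
exists s; split; first split.
- by move=> x Dx; apply/RP => i; apply: (sP i).1; exists x.
- move=> y yD; apply/RP => i; apply: (sP i).2 => _ [x Dx <-].
  by have /RP := yD _ Dx; apply.
have pF := tails_proper _ _ _ Rr Rt D0 dD.
(* A limit of a proper filter that contains [D] lies in the closure of [D]. *)
rewrite closureEcvg; exists (tails R D) => //; split.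
  apply: cvg_prod_topology => i.
  exact: cvg_tails Rt (@ra i) (@rt i) (Rproj i) (cT i) D0 dD DK (sP i).
move=> U DU; have [x Dx] := D0.
by exists x => // y [/DU].
Qed.

Theorem theorem3p3 (K : Type) (d : Order.disp_t) (A : Type)
    (X : A -> POrderedTopological.type d) :
  infinite_set [set: K] ->
  (forall a, updown_complete K (X a)) ->
  updown_complete K (prod_topology X).
Proof.
move=> _ cX; split.
  apply: (@complete_by_prod K A X (fun a => <=%O)) => [a|a|a|x y|a].
  - exact: le_refl.
  - exact: le_anti.
  - exact: le_trans.
  - exact: prod_leP.
  - exact: (cX a).1.
(* For the converse order, [directed_by] and [lub_by] unfold to down-directedness and infima. *)
apply: (@complete_by_prod K A X (fun a => >=%O)) => [a|a|a|x y|a].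
- exact: le_refl.
- exact: ge_anti.
- exact: ge_trans.
- exact: prod_leP.
- exact: (cX a).2.
Qed.
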